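(* Let $G$ be an abelian group. The abelianization $\mathrm{Pol}_2^{ab}(G)$ of $\mathrm{Pol}_2(G)$ fits into an extension $$1\to \mathrm{Sym}^2(G)\to \mathrm{Pol}_2^{ab}(G)\to G\to 1,$$ so that $\mathrm{Pol}_2^{ab}(G)$ is isomorphic to the twisted crossed product group $\mathrm{Sym}^2(G)\rtimes_\sigma G$ for the $2$-cocycle $\sigma\colon G\times G\to\mathrm{Sym}^2(G)$ given by $\sigma(g,h)=gh$ (the product of $g$ and $h$ in $\mathrm{Sym}^2(G)$).
   Context: For groups $G,H$ and $\varphi\colon G\to H$, put $(\Delta_k\varphi)(g):=\varphi(kg)\varphi(g)^{-1}$. A map is polynomial of degree $-1$ if it is constantly $1$, and polynomial of degree $d+1$ ($d\ge-1$) if $\Delta_k\varphi$ is polynomial of degree $d$ for all $k\in G$; quadratic means polynomial of degree $2$; unital means $\varphi(1)=1$. $\mathrm{Pol}_2(G)$ is the group with a universal unital quadratic map $\varphi\colon G\to\mathrm{Pol}_2(G)$: every unital quadratic map $G\to H$ to a group $H$ factors through $\varphi$ via a unique homomorphism $\mathrm{Pol}_2(G)\to H$. $\mathrm{Sym}^2(G)$ is the symmetric square of the abelian group $G$ over $\mathbb Z$, i.e. the quotient of $G\otimes_{\mathbb Z}G$ by the subgroup generated by all $g\otimes h-h\otimes g$; $gh$ is the class of $g\otimes h$. $\mathrm{Sym}^2(G)\rtimes_\sigma G$ is the set $\mathrm{Sym}^2(G)\times G$ with multiplication $(\xi_1,g_1)(\xi_2,g_2)=(\xi_1+\xi_2+\sigma(g_1,g_2),\,g_1+g_2)$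 (trivial action, $G$ written additively). *)

(* Defs.v *)
From HB Require Import structures.
From mathcomp Require Import all_boot all_algebra.
From mathcomp Require Import boolp.
From mathcomp Require Import freeg.

Set Implicit Arguments.
Unset Strict Implicit.
Unset Printing Implicit Defensive.

Import GRing.Theory.
Local Open Scope quotient_scope.
Local Open Scope group_scope.

(* MathComp has no quotient of a group by a normal subgroup, nor a tensor     *)
(* product, for possibly infinite groups.  Both are built below; membership   *)
(* in a generated subgroup is made boolean by excluded middle.                *)

Notation "{ 'group_hom' G -> H }" := (monoid.UMagmaMorphism.type G%type H%type)
  (at level 0, G at level 98, H at level 99,
   format "{ 'group_hom'  G  ->  H }") : type_scope.

Definition Delta (G H : groupType) (k : G) (f : G -> H) : G -> H :=
  fun g => f (k * g) * (f g)^-1.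

(* Degrees start at -1, hence the shift: "degree < n" is degree n - 1.        *)
Fixpoint polynomial_lt (G H : groupType) (n : nat) (f : G -> H) : Prop :=
  if n is m.+1 then forall k : G, polynomial_lt m (Delta k f)
  else forall g : G, f g = 1.

Definition polynomial (G H : groupType) (d : nat) (f : G -> H) : Prop :=
  polynomial_lt d.+1 f.

Definition quadratic (G H : groupType) (f : G -> H) : Prop := polynomial 2 f.

Definition unital (G H : groupType) (f : G -> H) : Prop := f 1 = 1.

(* [phi : G -> P] exhibits [P] as the group Pol_2(G).                         *)
Definition is_Pol2 (G P : groupType) (phi : G -> P) : Prop :=
  [/\ unital phi, quadratic phi
    & forall (H : groupType) (f : G -> H), unital f -> quadratic f ->
      exists2 h : {group_hom P -> H},
        (forall g, h (phi g) = f g) &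
        forall h' : {group_hom P -> H},
          (forall g, h' (phi g) = f g) -> forall x, h' x = h x].

Section Abelianization.
Variable P : groupType.
Implicit Types x y z : P.

Definition commutator_subgroup : {pred P} := fun x =>
  `[< forall S : {pred P}, group_closed S ->
        (forall a b : P, [~ a, b] \in S) -> x \in S >].

Lemma commutator_subgroupP x :
  reflect (forall S : {pred P}, group_closed S ->
             (forall a b : P, [~ a, b] \in S) -> x \in S)
          (x \in commutator_subgroup).
Proof. exact: asboolP. Qed.

Lemma commutator_subgroup_closed : group_closed commutator_subgroup.
Proof.
split=> [|x y /commutator_subgroupP Sx /commutator_subgroupP Sy].
  by apply/commutator_subgroupP => S [].
by apply/commutator_subgroupP => S cS RS; apply: cS.2; [apply: Sx|apply: Sy].
Qed.

Lemma commg_in_commutator_subgroup x y : [~ x, y] \in commutator_subgroup.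
Proof. by apply/commutator_subgroupP => S _; apply. Qed.

Lemma commutator_subgroup1 : 1 \in commutator_subgroup.
Proof. exact: commutator_subgroup_closed.1. Qed.

Lemma commutator_subgroupV x :
  x \in commutator_subgroup -> x^-1 \in commutator_subgroup.
Proof. exact: group_closedV commutator_subgroup_closed x. Qed.

Lemma commutator_subgroupM x y :
  x \in commutator_subgroup -> y \in commutator_subgroup ->
  x * y \in commutator_subgroup.
Proof. exact: group_closedM commutator_subgroup_closed x y. Qed.

Lemma commutator_subgroupJ x y :
  x \in commutator_subgroup -> x ^ y \in commutator_subgroup.
Proof.
move=> Dx; rewrite -[x ^ y](mulVKg x) -commgEl.
by apply: commutator_subgroupM => //; apply: commg_in_commutator_subgroup.
Qed.

Definition ab_equiv x y := x^-1 * y \in commutator_subgroup.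

Lemma ab_equiv_is_equiv : equiv_class_of ab_equiv.
Proof.
have sym x y : ab_equiv x y -> ab_equiv y x.
  by move/commutator_subgroupV; rewrite /ab_equiv invgM invgK.
split=> [x|x y|y x z].
- by rewrite /ab_equiv mulVg commutator_subgroup1.
- by apply/idP/idP; apply: sym.
- move=> xy yz; have := commutator_subgroupM xy yz.
  by rewrite /ab_equiv -mulgA mulVKg.
Qed.

Canonical ab_equiv_equiv := EquivRelPack ab_equiv_is_equiv.
Canonical ab_equiv_encModRel := defaultEncModRel ab_equiv.

Definition abelianization := {eq_quot ab_equiv}.
HB.instance Definition _ := EqQuotient.on abelianization.
HB.instance Definition _ := Choice.on abelianization.

Definition to_ab : P -> abelianization := \pi.

Lemma to_ab_eq x y : to_ab x = to_ab y <-> x^-1 * y \in commutator_subgroup.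
Proof. by split=> [/eqmodP|?]; last exact/eqmodP. Qed.

Lemma to_ab_surj (a : abelianization) : exists x, a = to_ab x.
Proof. by exists (repr a); rewrite /to_ab reprK. Qed.

Definition ab_mul (a b : abelianization) : abelianization :=
  to_ab (repr a * repr b).
Definition ab_inv (a : abelianization) : abelianization := to_ab (repr a)^-1.

Lemma to_ab_repr x : x^-1 * repr (to_ab x) \in commutator_subgroup.
Proof. by apply/to_ab_eq; rewrite /to_ab reprK. Qed.

Lemma ab_mulE x y : ab_mul (to_ab x) (to_ab y) = to_ab (x * y).
Proof.
apply/esym/to_ab_eq; set x' := repr (to_ab x); set y' := repr (to_ab y).
have -> : (x * y)^-1 * (x' * y') = (x^-1 * x') ^ y * (y^-1 * y').
  by rewrite invgM conjgE -!mulgA mulVKg.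
apply: commutator_subgroupM; last exact: to_ab_repr.
exact/commutator_subgroupJ/to_ab_repr.
Qed.

Lemma ab_invE x : ab_inv (to_ab x) = to_ab x^-1.
Proof.
apply/esym/to_ab_eq; rewrite invgK.
have /commutator_subgroupV := commutator_subgroupJ x^-1 (to_ab_repr x).
by rewrite conjgE invgK mulgA mulVKg invgM invgK.
Qed.

Lemma ab_mulA : associative ab_mul.
Proof.
move=> a b c; have [x ->] := to_ab_surj a; have [y ->] := to_ab_surj b.
by have [z ->] := to_ab_surj c; rewrite !ab_mulE mulgA.
Qed.

Lemma ab_mul1 : left_id (to_ab 1) ab_mul.
Proof. by move=> a; have [x ->] := to_ab_surj a; rewrite ab_mulE mul1g. Qed.

Lemma ab_1mul : right_id (to_ab 1) ab_mul.
Proof. by move=> a; have [x ->] := to_ab_surj a; rewrite ab_mulE mulg1. Qed.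

Lemma ab_mulV : left_inverse (to_ab 1) ab_inv ab_mul.
Proof.
by move=> a; have [x ->] := to_ab_surj a; rewrite ab_invE ab_mulE mulVg.
Qed.

Lemma ab_Vmul : right_inverse (to_ab 1) ab_inv ab_mul.
Proof.
by move=> a; have [x ->] := to_ab_surj a; rewrite ab_invE ab_mulE mulgV.
Qed.

HB.instance Definition _ := isGroup.Build abelianization
  ab_mulA ab_mul1 ab_1mul ab_mulV ab_Vmul.

Lemma to_abM : {morph to_ab : x y / x * y}.
Proof. by move=> x y; rewrite -ab_mulE. Qed.

HB.instance Definition _ := isMultiplicative.Build P abelianization to_ab to_abM.
HB.instance Definition _ :=
  Multiplicative_isUMagmaMorphism.Build P abelianization to_ab erefl.

Lemma abelianizationC : forall a b : abelianization, a * b = b * a.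
Proof.
move=> a b; have [x ->] := to_ab_surj a; have [y ->] := to_ab_surj b.
rewrite -!to_abM; apply/to_ab_eq.
by rewrite invgM -mulgA; apply: commg_in_commutator_subgroup.
Qed.

End Abelianization.

Section ZSpan.
Variables (V : zmodType) (A : V -> Prop).
Local Open Scope ring_scope.

Definition zspan : {pred V} := fun x =>
  `[< forall S : {pred V}, zmod_closed S ->
        (forall a, A a -> a \in S) -> x \in S >].

Lemma zspanP x :
  reflect (forall S : {pred V}, zmod_closed S ->
             (forall a, A a -> a \in S) -> x \in S) (x \in zspan).
Proof. exact: asboolP. Qed.

Lemma zspan_closed : zmod_closed zspan.
Proof.
split=> [|x y /zspanP Sx /zspanP Sy]; first by apply/zspanP => S [].
by apply/zspanP => S cS AS; apply: cS.2; [apply: Sx|apply: Sy].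
Qed.

Lemma mem_zspan a : A a -> a \in zspan.
Proof. by move=> Aa; apply/zspanP => S _; apply. Qed.

HB.instance Definition _ := GRing.isZmodClosed.Build V zspan zspan_closed.

Definition quotz : zmodType := Quotient.quot zspan.

Definition to_quotz : V -> quotz := \pi_(Quotient.quot zspan).

Lemma to_quotz_is_zmod_morphism : zmod_morphism to_quotz.
Proof. exact: raddfB. Qed.

HB.instance Definition _ :=
  GRing.isZmodMorphism.Build V quotz to_quotz to_quotz_is_zmod_morphism.

Lemma to_quotz_eq x y : to_quotz x = to_quotz y <-> x - y \in zspan.
Proof.
rewrite -[_ \in _]Quotient.equivE.
by split=> [/eqmodP|?]; last exact/eqmodP.
Qed.

End ZSpan.

Section Sym2.
Variable G : zmodType.
Local Open Scope ring_scope.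

Local Notation gen g h := (<< ((g : G), (h : G)) >> : {freeg (G * G)%type}).

Inductive bilinear_rel : {freeg (G * G)%type} -> Prop :=
| bilinear_rel_l g1 g2 h :
    bilinear_rel (gen (g1 + g2) h - gen g1 h - gen g2 h)
| bilinear_rel_r g h1 h2 :
    bilinear_rel (gen g (h1 + h2) - gen g h1 - gen g h2).

(* G (x)_Z G *)
Definition tensor2 : zmodType := quotz bilinear_rel.
Definition tens (g h : G) : tensor2 := to_quotz bilinear_rel (gen g h).

Definition symmetry_rel (t : tensor2) : Prop :=
  exists g h : G, t = tens g h - tens h g.

Definition Sym2 : zmodType := quotz symmetry_rel.
Definition sym_mul (g h : G) : Sym2 := to_quotz symmetry_rel (tens g h).

Lemma tensDl g1 g2 h : tens (g1 + g2) h = tens g1 h + tens g2 h.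
Proof.
rewrite /tens -raddfD; apply/to_quotz_eq; rewrite opprD addrA.
exact/mem_zspan/bilinear_rel_l.
Qed.

Lemma tensDr g h1 h2 : tens g (h1 + h2) = tens g h1 + tens g h2.
Proof.
rewrite /tens -raddfD; apply/to_quotz_eq; rewrite opprD addrA.
exact/mem_zspan/bilinear_rel_r.
Qed.

Lemma sym_mulDl g1 g2 h : sym_mul (g1 + g2) h = sym_mul g1 h + sym_mul g2 h.
Proof. by rewrite /sym_mul tensDl raddfD. Qed.

Lemma sym_mulDr g h1 h2 : sym_mul g (h1 + h2) = sym_mul g h1 + sym_mul g h2.
Proof. by rewrite /sym_mul tensDr raddfD. Qed.

Lemma sym_mulC g h : sym_mul g h = sym_mul h g.
Proof. by apply/to_quotz_eq/mem_zspan; exists g, h. Qed.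

End Sym2.

Record cocycle2 (G A : zmodType) := Cocycle2 {
  cocycle_fun :> G -> G -> A;
  cocycleP : forall g h k : G,
    (cocycle_fun g h + cocycle_fun (g + h) k
     = cocycle_fun h k + cocycle_fun g (h + k))%R
}.

(* The unused argument [s] selects the group structure put on [A * G] below.  *)
Definition twisted_product (G A : zmodType) (s : cocycle2 G A) : Type :=
  (A * G)%type.

Section TwistedProduct.
Variables (G A : zmodType) (s : cocycle2 G A).
Local Open Scope ring_scope.

Local Notation twisted_product := (twisted_product s).

HB.instance Definition _ := Choice.copy twisted_product (A * G)%type.

Definition tw_mul (x y : twisted_product) : twisted_product :=
  (x.1 + y.1 + s x.2 y.2, x.2 + y.2).

(* s is not assumed to be normalized. *)
Definition tw_one : twisted_product := (- s 0 0, 0).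
Definition tw_inv (x : twisted_product) : twisted_product :=
  (- x.1 - s (- x.2) x.2 - s 0 0, - x.2).

Lemma cocycle0l g : s 0 g = s 0 0.
Proof. by have := cocycleP s 0 0 g; rewrite !add0r => /addIr. Qed.

Lemma cocycle0r g : s g 0 = s 0 0.
Proof. by have := cocycleP s g 0 0; rewrite !addr0 => /addIr. Qed.

Lemma cocycleNr g : s g (- g) = s (- g) g.
Proof.
by have := cocycleP s g (- g) g; rewrite subrr addNr cocycle0l cocycle0r => /addIr.
Qed.

Lemma tw_mulA : associative tw_mul.
Proof.
move=> [a g] [b h] [c k]; rewrite /tw_mul /=; congr (_, _); last exact: addrA.
rewrite [a + (b + c + _)]addrA [a + (b + c)]addrA.
rewrite -[LHS]addrA -cocycleP addrA; congr (_ + _).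
by rewrite addrAC.
Qed.

Lemma tw_mul1 : left_id tw_one tw_mul.
Proof.
by case=> a g; rewrite /tw_mul /= cocycle0l add0r addrAC addNr add0r.
Qed.

Lemma tw_1mul : right_id tw_one tw_mul.
Proof. by case=> a g; rewrite /tw_mul /= cocycle0r addr0 subrK. Qed.

Lemma tw_mulV : left_inverse tw_one tw_inv tw_mul.
Proof.
case=> a g; rewrite /tw_mul /tw_one /= addNr; congr (_, _).
rewrite (addrAC _ (- s 0 0) a) (addrAC (- a)) addNr add0r.
by rewrite addrAC addNr add0r.
Qed.

Lemma tw_Vmul : right_inverse tw_one tw_inv tw_mul.
Proof.
case=> a g; rewrite /tw_mul /tw_one /= subrr cocycleNr; congr (_, _).
by rewrite !addrA subrr add0r addrAC addNr add0r.
Qed.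

HB.instance Definition _ := isGroup.Build twisted_product
  tw_mulA tw_mul1 tw_1mul tw_mulV tw_Vmul.

End TwistedProduct.

Section Sigma.
Variable G : zmodType.

Lemma sym_mul_cocycle (g h k : G) :
  (sym_mul g h + sym_mul (g + h) k = sym_mul h k + sym_mul g (h + k))%R.
Proof. by rewrite sym_mulDl sym_mulDr addrA addrC addrA. Qed.

Definition sigma : cocycle2 G (Sym2 G) := Cocycle2 sym_mul_cocycle.

End Sigma.

(* 1 -> A -> E -> B -> 1 is exact. *)
Definition is_extension (A E B : groupType)
    (i : {group_hom A -> E}) (p : {group_hom E -> B}) : Prop :=
  [/\ injective i,
      (forall b, exists x, p x = b)
    & forall x, p x = 1 <-> exists a, x = i a].

Section Pol2Existence.
Variable G : groupType.

Inductive word : Type :=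
| Gen of G | One | Mul of word & word | Inv of word.

HB.instance Definition _ := gen_eqMixin word.
HB.instance Definition _ := gen_choiceMixin word.

Fixpoint eval (H : groupType) (f : G -> H) (w : word) : H :=
  match w with
  | Gen g => f g
  | One => 1
  | Mul u v => eval f u * eval f v
  | Inv u => (eval f u)^-1
  end.

(* Two words are identified when every unital quadratic map does so. *)
Definition word_equiv (u v : word) : bool :=
  `[< forall (H : groupType) (f : G -> H), unital f -> quadratic f ->
        eval f u = eval f v >].

Lemma word_equivP u v :
  reflect (forall (H : groupType) (f : G -> H), unital f -> quadratic f ->
             eval f u = eval f v) (word_equiv u v).
Proof. exact: asboolP. Qed.

Lemma word_equiv_is_equiv : equiv_class_of word_equiv.
Proof.
split=> [u|u v|v u w].
- exact/word_equivP.
- by apply/word_equivP/word_equivP => E H f uf qf; rewrite E.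
- move=> /word_equivP E1 /word_equivP E2; apply/word_equivP => H f uf qf.
  by rewrite E1 ?E2.
Qed.

Canonical word_equiv_equiv := EquivRelPack word_equiv_is_equiv.
Canonical word_equiv_encModRel := defaultEncModRel word_equiv.

Definition Pol2 := {eq_quot word_equiv}.
HB.instance Definition _ := EqQuotient.on Pol2.
HB.instance Definition _ := Choice.on Pol2.

Definition cl : word -> Pol2 := \pi.

Lemma cl_eq u v : cl u = cl v <->
  forall (H : groupType) (f : G -> H), unital f -> quadratic f ->
    eval f u = eval f v.
Proof. by split=> [/eqmodP/word_equivP|/word_equivP ?]; last exact/eqmodP. Qed.

Lemma eval_repr (H : groupType) (f : G -> H) u :
  unital f -> quadratic f -> eval f (repr (cl u)) = eval f u.
Proof. by move: H f; apply/cl_eq; rewrite /cl reprK. Qed.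

Lemma cl_surj (a : Pol2) : exists u, a = cl u.
Proof. by exists (repr a); rewrite /cl reprK. Qed.

Definition Pol2_mul (a b : Pol2) : Pol2 := cl (Mul (repr a) (repr b)).
Definition Pol2_inv (a : Pol2) : Pol2 := cl (Inv (repr a)).

Lemma Pol2_mulE u v : Pol2_mul (cl u) (cl v) = cl (Mul u v).
Proof. by apply/cl_eq => H f uf qf /=; rewrite !eval_repr. Qed.

Lemma Pol2_invE u : Pol2_inv (cl u) = cl (Inv u).
Proof. by apply/cl_eq => H f uf qf /=; rewrite !eval_repr. Qed.

Lemma Pol2_mulA : associative Pol2_mul.
Proof.
move=> a b c; have [x ->] := cl_surj a; have [y ->] := cl_surj b.
have [z ->] := cl_surj c; rewrite !Pol2_mulE.
by apply/cl_eq => H f _ _ /=; rewrite mulgA.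
Qed.

Lemma Pol2_mul1 : left_id (cl One) Pol2_mul.
Proof.
move=> a; have [x ->] := cl_surj a; rewrite Pol2_mulE.
by apply/cl_eq => H f _ _ /=; rewrite mul1g.
Qed.

Lemma Pol2_1mul : right_id (cl One) Pol2_mul.
Proof.
move=> a; have [x ->] := cl_surj a; rewrite Pol2_mulE.
by apply/cl_eq => H f _ _ /=; rewrite mulg1.
Qed.

Lemma Pol2_mulV : left_inverse (cl One) Pol2_inv Pol2_mul.
Proof.
move=> a; have [x ->] := cl_surj a; rewrite Pol2_invE Pol2_mulE.
by apply/cl_eq => H f _ _ /=; rewrite mulVg.
Qed.

Lemma Pol2_Vmul : right_inverse (cl One) Pol2_inv Pol2_mul.
Proof.
move=> a; have [x ->] := cl_surj a; rewrite Pol2_invE Pol2_mulE.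
by apply/cl_eq => H f _ _ /=; rewrite mulgV.
Qed.

HB.instance Definition _ := isGroup.Build Pol2
  Pol2_mulA Pol2_mul1 Pol2_1mul Pol2_mulV Pol2_Vmul.

Definition Pol2_map (g : G) : Pol2 := cl (Gen g).

Lemma clM u v : cl u * cl v = cl (Mul u v). Proof. exact: Pol2_mulE. Qed.
Lemma clV u : (cl u)^-1 = cl (Inv u). Proof. exact: Pol2_invE. Qed.

Section Lift.
Variables (H : groupType) (f : G -> H) (uf : unital f) (qf : quadratic f).

Definition Pol2_lift (a : Pol2) : H := eval f (repr a).

Lemma Pol2_lift_cl u : Pol2_lift (cl u) = eval f u.
Proof. exact: eval_repr. Qed.

Lemma Pol2_liftM : {morph Pol2_lift : x y / x * y}.
Proof.
move=> a b; have [x ->] := cl_surj a; have [y ->] := cl_surj b.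
by rewrite clM !Pol2_lift_cl.
Qed.

Lemma Pol2_lift1 : Pol2_lift 1 = 1.
Proof. exact: Pol2_lift_cl. Qed.

HB.instance Definition _ := isMultiplicative.Build Pol2 H Pol2_lift Pol2_liftM.
HB.instance Definition _ :=
  Multiplicative_isUMagmaMorphism.Build Pol2 H Pol2_lift Pol2_lift1.

Definition Pol2_lift_hom : {group_hom Pol2 -> H} := Pol2_lift.

End Lift.

Lemma Pol2P : is_Pol2 Pol2_map.
Proof.
split.
- by apply/cl_eq => H f uf _; exact: uf.
- move=> k1 k2 k3 g; rewrite /Delta /Pol2_map !(clM, clV).
  apply/cl_eq => H f uf qf /=.
  by do ![rewrite eval_repr //=]; apply: (qf k1 k2 k3 g).
move=> H f uf qf; exists (Pol2_lift_hom uf qf).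
  by move=> g; exact: Pol2_lift_cl.
move=> h' Eh a; have [w ->] := cl_surj a.
rewrite /Pol2_lift_hom /= Pol2_lift_cl //.
elim: w => [g||u IHu v IHv|u IHu] /=; first exact: Eh.
- by have -> : cl One = 1 by []; rewrite gmulf1.
- by rewrite -clM gmulfM IHu IHv.
- by rewrite -clV gmulfV IHu.
Qed.

End Pol2Existence.

(* Main.v *)
(* The map s(g) = (0, g) from G to E, the twisted product of Sym^2(G) and G,  *)
(* is quadratic: its iterated differences are (- k g, k), (- k l, 0) and      *)
(* (0, 0).  As E is commutative, s induces Theta from Pol_2^ab(G) to E.       *)
(* Conversely, for the universal map f of G to Pol_2^ab(G), quadraticity says *)
(* that f(g) f(h) f(g + h)^-1 is bilinear, and it is symmetric; hence it      *)
(* defines i from Sym^2(G) to Pol_2^ab(G), and (xi, g) |-> i(xi) f(g) is a    *)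
(* homomorphism inverse to Theta.                                             *)
From HB Require Import structures.
Require Import Defs.
From mathcomp Require Import all_boot all_algebra.
From mathcomp Require Import freeg.

Set Implicit Arguments.
Unset Strict Implicit.
Unset Printing Implicit Defensive.

Import GRing.Theory.
Local Open Scope group_scope.

(** [Theta] and the map [Psi], (xi, g) |-> i(xi) f(g), are inverse for two reasons. [Theta] after
    [Psi] reduces to Theta(i xi) = (xi, 0), checked on the generators g h by [Sym2_ind]. [Psi] after
    [Theta] uses the uniqueness half of the universal property: composed with [to_ab], it agrees
    with [to_ab] on the image of [phi]. The extension is then transported from the twisted product,
    with [p] the second component of [Theta]. *)

Section Sym2Lift.
Local Open Scope quotient_scope.
Local Open Scope ring_scope.

Lemma to_quotz_surj (V : zmodType) (R : V -> Prop) (a : quotz R) :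
  exists x, a = to_quotz R x.
Proof. by exists (repr a); rewrite /to_quotz reprK. Qed.

(** The kernel of [f] is a subgroup containing [R], hence contains its span, so evaluating [f] on a
    chosen representative is well defined. *)
Lemma quotz_lift (V W : zmodType) (R : V -> Prop) (f : {additive V -> W}) :
  (forall a, R a -> f a = 0) ->
  exists f' : {additive quotz R -> W}, forall x, f' (to_quotz R x) = f x.
Proof.
move=> fR; pose f' (a : quotz R) := f (repr a).
have f'E x : f' (to_quotz R x) = f x.
  have /to_quotz_eq/zspanP/(_ [pred a | f a == 0]) :
      to_quotz R (repr (to_quotz R x)) = to_quotz R x.
    by rewrite /to_quotz reprK.
  rewrite inE raddfB subr_eq0 => E; apply/eqP/E => [|a /fR fa0].
    split=> [|a b]; rewrite !inE ?raddf0 // raddfB => /eqP-> /eqP->.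
    by rewrite subrr.
  by rewrite inE fa0.
have f'B : zmod_morphism f'.
  move=> a b; have [x ->] := to_quotz_surj a; have [y ->] := to_quotz_surj b.
  by rewrite -raddfB !f'E raddfB.
pose F := GRing.isZmodMorphism.Build _ _ f' f'B.
pose f'' : {additive quotz R -> W} := HB.pack f' F.
by exists f''.
Qed.

(** Both quotient maps are onto, and the free abelian group on pairs is generated by the pairs. *)
Lemma Sym2_ind (G : zmodType) (S : {pred Sym2 G}) : zmod_closed S ->
  (forall g h, sym_mul g h \in S) -> forall xi, xi \in S.
Proof.
move=> cS Smul; pose Z := GRing.isZmodClosed.Build _ S cS.
pose S' : zmodClosed (Sym2 G) := HB.pack S Z.
move=> xi; have [t ->] := to_quotz_surj xi; have [D ->] := to_quotz_surj t.
rewrite -[_ \in S]/(_ \in S').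
rewrite -(freeg_sumE D) !raddf_sum; apply: rpred_sum => -[g h] _.
have -> : << coeff (g, h) D *g (g, h) >> = << (g, h) >> *~ coeff (g, h) D.
  by rewrite freeg_mulz intz.
by rewrite !raddfMz; apply: rpredMz; apply: Smul.
Qed.

Lemma Sym2_lift (G W : zmodType) (B : G -> G -> W) :
  (forall g1 g2 h, B (g1 + g2) h = B g1 h + B g2 h) ->
  (forall g h, B g h = B h g) ->
  exists i : {additive Sym2 G -> W}, forall g h, i (sym_mul g h) = B g h.
Proof.
(* [zmodule W] is [W] as a module over the integers, the form in which the free group's lift
   [fglift] applies. *)
move=> BDl BC; pose B' (z : G * G) : zmodule W := B z.1 z.2.
pose F := GRing.isZmodMorphism.Build _ _ (fglift B') (lift_is_additive B').
pose b : {additive {freeg (G * G)%type} -> W} := HB.pack (fglift B' : _ -> W) F.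
have bU g h : b << (g, h) >> = B g h by rewrite [LHS]liftU scale1r.
have [|t tE] := quotz_lift (R := @bilinear_rel G) (f := b).
  move=> _ [g1 g2 h|g h1 h2]; rewrite !raddfB !bU.
    by rewrite BDl addrAC addrK subrr.
  by rewrite BC BDl ![B _ g]BC addrAC addrK subrr.
have [|i iE] := quotz_lift (R := @symmetry_rel G) (f := t).
  by move=> _ [g [h ->]]; rewrite raddfB !tE !bU BC subrr.
by exists i => g h; rewrite iE tE bU.
Qed.

(** The defect of additivity of a unital quadratic map is symmetric and bilinear. Its sign is chosen
    so that the section g |-> (0, g) yields (g h, 0). *)
Lemma quadratic_Sym2_lift (G W : zmodType)
    (f : Algebra.to_multiplicative G -> Algebra.to_multiplicative W) :
  unital f -> quadratic f ->
  exists i : {additive Sym2 G -> W},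
    forall g h, i (sym_mul g h) = (f g : W) + (f h : W) - (f (g + h) : W).
Proof.
move=> uf qf; pose F (g : G) : W := f g.
apply: (Sym2_lift (B := fun g h => F g + F h - F (g + h))) => [a b c|g h]; last first.
  by rewrite (addrC (F g)) (addrC g).
have F0 : F 0 = 0 by exact: uf.
(* Up to sign, the third difference of F at 0 is the defect of additivity of  *)
(* (g, h) |-> F g + F h - F (g + h) in its first variable.                    *)
have Q : F (c + (b + (a + 0))) - F (b + (a + 0))
      - (F (c + (a + 0)) - F (a + 0))
      - (F (c + (b + 0)) - F (b + 0) - (F (c + 0) - F 0)) = 0.
  exact: (qf c b a 0).
rewrite !addr0 F0 subr0 (addrC b) (addrC c) (addrC c a) (addrC c b) in Q.
move: Q => /subr0_eq/eqP; rewrite !subr_eq => /eqP ->.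
(* The permutation brings the two opposite copies of [F (a + b)] to the front; the other six terms
   form the right-hand side. *)
by rewrite !(opprD, opprK) !addrA [LHS](ACl (1*8*7*2*6*4*5*3)) /= subrr add0r.
Qed.
End Sym2Lift.

Lemma quadratic_Sym2_hom (A : groupType) (G : zmodType)
    (f : Algebra.to_multiplicative G -> A) :
  commutative (fun x y : A => x * y) -> unital f -> quadratic f ->
  exists i : {group_hom Algebra.to_multiplicative (Sym2 G) -> A},
    forall g h, i (sym_mul g h) = f g * f h * (f (g + h)%R)^-1.
Proof.
move=> mulC uf qf.
(* [W] is [A] with the same operations written additively, so the additive lift can be reread as a
   group homomorphism. *)
pose W : zmodType :=
  HB.pack A (GRing.isZmodule.Build A (@mulgA A) mulC (@mul1g A) (@mulVg A)).
have [i iE] := quadratic_Sym2_lift (W := W) uf qf.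
pose i' : Algebra.to_multiplicative (Sym2 G) -> A := i.
have i'M : {morph i' : x y / x * y} by move=> x y; exact: (raddfD i x y).
have i'1 : i' 1 = 1 by exact: (raddf0 i).
pose M1 := isMultiplicative.Build _ _ i' i'M.
pose M2 := Multiplicative_isUMagmaMorphism.Build _ _ i' i'1.
pose i2 : {group_hom Algebra.to_multiplicative (Sym2 G) -> A} := HB.pack i' M1 M2.
by exists i2.
Qed.

Lemma polynomial_lt_hom (G H K : groupType) (h : {group_hom H -> K}) n
    (f : G -> H) (f' : G -> K) :
  (forall g, f' g = h (f g)) -> polynomial_lt n f -> polynomial_lt n f'.
Proof.
elim: n f f' => [|n IHn] f f' Ef /= pf => [g|k]; first by rewrite Ef pf gmulf1.
by apply: (IHn (Delta k f)) => // g; rewrite /Delta !Ef gmulfM gmulfV.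
Qed.

(** Commutativity of [A] puts every commutator in the kernel of [f], so [f] is constant on cosets of
    the commutator subgroup. *)
Lemma abelianization_lift (P A : groupType) (f : {group_hom P -> A}) :
  commutative (fun x y : A => x * y) ->
  exists f' : {group_hom abelianization P -> A}, forall x, f' (to_ab x) = f x.
Proof.
move=> mulC; pose f' (a : abelianization P) := f (repr a).
have f'E x : f' (to_ab x) = f x.
  have /to_ab_eq/commutator_subgroupP/(_ [pred a | f a == 1]) :
    to_ab (repr (to_ab x)) = to_ab x by rewrite /to_ab reprK.
  rewrite inE gmulfM gmulfV => E; rewrite -[RHS](mulVKg (f (repr (to_ab x)))).
  rewrite (eqP (E _ _)) ?mulg1 //.
    split=> [|a b]; rewrite !inE ?gmulf1 // gmulfM ?gmulfV => /eqP-> /eqP->.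
    by rewrite ?invg1 mulg1.
  by move=> a b; rewrite inE gmulfR commgEl conjgE [f a * f b]mulC mulKg mulVg.
have f'M : {morph f' : x y / x * y}.
  move=> a b; have [x ->] := to_ab_surj a; have [y ->] := to_ab_surj b.
  by rewrite -to_abM !f'E gmulfM.
have f'1 : f' 1 = 1 by rewrite [LHS](f'E 1) gmulf1.
pose M1 := isMultiplicative.Build _ _ f' f'M.
pose M2 := Multiplicative_isUMagmaMorphism.Build _ _ f' f'1.
pose f2 : {group_hom abelianization P -> A} := HB.pack f' M1 M2.
by exists f2.
Qed.

Section TwistedSection.
Variable G : zmodType.
Local Notation E := (twisted_product (sigma G)).
Local Open Scope ring_scope.

Definition twisted_section (g : Algebra.to_multiplicative G) : E := (0, g).

Lemma sigma0l g : sigma G 0 g = 0.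
Proof. by apply: (addrI (sigma G 0 g)); rewrite -sym_mulDl !addr0. Qed.

Lemma twisted_sigmaC : commutative (fun x y : E => (x * y)%g).
Proof.
move=> [a g] [b h]; rewrite -[LHS]/((a + b + sym_mul g h, g + h) : E).
by rewrite (addrC a) (addrC g) sym_mulC.
Qed.

Lemma twisted_mulE (x y : E) :
  (x * y)%g = (x.1 + y.1 + sym_mul x.2 y.2, x.2 + y.2) :> E.
Proof. by []. Qed.

Lemma twisted_section_unital : unital twisted_section.
Proof.
rewrite /unital /twisted_section -[RHS]/((- sigma G 0 0, 0) : E).
by rewrite sigma0l oppr0.
Qed.

(** Solving z y = x for z bypasses the cocycle terms of the inverse. *)
Lemma twisted_divE (x y : E) :
  (x * y^-1)%g = (x.1 - y.1 - sym_mul (x.2 - y.2) y.2, x.2 - y.2) :> E.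
Proof.
apply: (canLR (mulgK _)); case: x y => [a g] [b h]; symmetry.
rewrite -[LHS]/((_ - _ - _ + b + sym_mul (g - h) h, g - h + h) : E).
by rewrite subrK addrAC !subrK.
Qed.

Lemma Delta_twisted_section k g :
  Delta k twisted_section g = (- sym_mul (k : G) (g : G), k : G).
Proof.
rewrite /Delta twisted_divE /= -[(k * g)%g]/((k : G) + (g : G)).
by rewrite addrK subr0 sub0r.
Qed.

Lemma twisted_section_quadratic : quadratic twisted_section.
Proof.
have D2 k l g : Delta l (Delta k twisted_section) g = (- sym_mul (k : G) (l : G), 0).
  rewrite /Delta -!/(Delta k twisted_section _) !Delta_twisted_section.
  rewrite twisted_divE /= -[(l * g)%g]/((l : G) + (g : G)) sym_mulDr.
  by rewrite subrr [sym_mul 0 _]sigma0l subr0 opprD opprK subrK.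
(* The second difference does not depend on [g], so the third is a quotient of equal elements. *)
by move=> k l m g; rewrite [LHS]/Delta !D2 mulgV.
Qed.

End TwistedSection.

Theorem corollary1p4 (G : zmodType) (P : groupType)
    (phi : Algebra.to_multiplicative G -> P) (hphi : is_Pol2 phi) :
  exists (i : {group_hom Algebra.to_multiplicative (Sym2 G) -> abelianization P})
         (p : {group_hom abelianization P -> Algebra.to_multiplicative G}),
    is_extension i p /\
    exists Theta : {group_hom abelianization P -> twisted_product (sigma G)},
      [/\ bijective Theta,
          forall xi : Sym2 G, Theta (i xi) = (xi, 0%R)
        & forall x : abelianization P, (Theta x).2 = p x].
Proof.
have [uphi qphi univ] := hphi.
have [theta thetaE _] :=
  univ _ _ (@twisted_section_unital G) (@twisted_section_quadratic G).
have [Theta ThetaE] := abelianization_lift theta (@twisted_sigmaC G).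
pose f g := to_ab (phi g).
have uf : unital f by rewrite /unital /f uphi gmulf1.
have qf : quadratic f by apply: polynomial_lt_hom qphi.
have [i iE] := quadratic_Sym2_hom (@abelianizationC P) uf qf.
have Thetaf g : Theta (f g) = (0%R, g) by rewrite ThetaE thetaE.
have i0 : i 0%R = 1 by exact: (gmulf1 (s := i)).
have Thetai (xi : Sym2 G) : Theta (i xi) = (xi, 0%R).
  pose S := [pred xi : Sym2 G | Theta (i xi) == (xi, 0%R)].
  apply/eqP; rewrite -[_ == _]/(xi \in S); apply: Sym2_ind xi => [|g h].
    split=> [|x y].
      by rewrite inE i0 gmulf1 -(twisted_section_unital G).
    rewrite !inE => /eqP xE /eqP yE.
    have -> : i (x - y)%R = i x * (i y)^-1 by rewrite -gmulfV -gmulfM.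
    by rewrite gmulfM gmulfV xE yE twisted_divE /= !subr0 [sym_mul _ _]sigma0l subr0.
  rewrite inE iE !gmulfM gmulfV !Thetaf twisted_divE twisted_mulE /= !add0r.
  by rewrite subrr [sym_mul 0 _]sigma0l !subr0.
pose Psi (x : twisted_product (sigma G)) : abelianization P := i x.1 * f x.2.
have ThetaPsi : cancel Psi Theta.
  case=> a g; rewrite /Psi gmulfM Thetai Thetaf twisted_mulE /=.
  by rewrite [sym_mul _ _]sigma0l !addr0 add0r.
have Psi_section g : Psi (twisted_section g) = f g by rewrite /Psi i0 mul1g.
have Psi1 : Psi 1 = 1 by rewrite -(twisted_section_unital G) Psi_section.
have PsiM : {morph Psi : x y / x * y}.
  move=> [a g] [b h]; rewrite twisted_mulE /Psi /=.
  have -> : i (a + b + sym_mul g h)%R = i a * i b * i (sym_mul g h).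
    by rewrite -!gmulfM.
  (* By the choice of [i], i(g h) f(g + h) = f(g) f(h): the cocycle absorbs exactly the defect of
     [f]. *)
  rewrite iE -!mulgA mulVg mulg1; congr (_ * _).
  by rewrite !mulgA [i b * _]abelianizationC.
pose M1 := isMultiplicative.Build _ _ Psi PsiM.
pose M2 := Multiplicative_isUMagmaMorphism.Build _ _ Psi Psi1.
pose Psi' : {group_hom twisted_product (sigma G) -> abelianization P} :=
  HB.pack Psi M1 M2.
have PsiTheta : cancel Theta Psi.
  (* [Psi' \o theta] and [to_ab] both extend [f] along [phi], so both equal [r]. *)
  have [r _ runiq] := univ _ f uf qf.
  have Psir := runiq (Psi' \o theta : {group_hom _ -> _}).
  have abr := runiq (@to_ab P : {group_hom _ -> _}).
  move=> a; have [x ->] := to_ab_surj a; rewrite ThetaE.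
  rewrite [LHS]Psir ?[RHS]abr // => g /=.
  by rewrite thetaE; exact: Psi_section.
pose p (a : abelianization P) : Algebra.to_multiplicative G := (Theta a).2.
have pM : {morph p : x y / x * y} by move=> x y; rewrite /p gmulfM.
have p1 : p 1 = 1 by rewrite /p gmulf1.
pose p' : {group_hom abelianization P -> Algebra.to_multiplicative G} :=
  HB.pack p (isMultiplicative.Build _ _ p pM)
            (Multiplicative_isUMagmaMorphism.Build _ _ p p1).
exists i, p'; split; last first.
  by exists Theta; split=> //; exists Psi.
split.
- by move=> x y /(congr1 Theta); rewrite !Thetai => -[].
- by move=> b; exists (f b); rewrite /= /p Thetaf.
move=> x; split=> [px1|[xi ->]]; last by rewrite /= /p Thetai.
exists (Theta x).1; apply: (can_inj PsiTheta); rewrite Thetai.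
by rewrite [LHS]surjective_pairing; congr (_, _); exact: px1.
Qed.
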